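(* For every $n\ge1$ and all integers $a_1,\dots,a_n$, the virtual twist knot diagram $VT(a_1,\dots,a_n)$ satisfies $$2\,\overline{\Delta}_0(VT(a_1,\dots,a_n))(-1,-1) = (-1)^{\delta+s(n)+\sum_{i=1}^{n}\lfloor |a_i|/2\rfloor}\,OW(VT(a_1,\dots,a_n)),$$ where $OW$ denotes the odd writhe.
   Context: Notation. For an integer $k$, $p(k)=0$ if $k$ is even and $p(k)=1$ if $k$ is odd. For integers $a_1,\dots,a_n$: $s(0)=0$, $s(i)=\sum_{j=1}^{i}(a_j+1)$, $\delta=\sum_{j=1}^n p(a_j)p(s(j))$. Alexander matrix. An oriented virtual link diagram has classical crossings (with over/under information and a sign $\pm$) and virtual crossings. An arc runs from one classical crossing to the next classical crossing, ignoring virtual crossings; a diagram $D$ with $N'$ classical crossings has $2N'$ arcs, which are given a fixed order. At a classical crossing let $\omega,\omega'$ be the incoming and outgoing arcs of the over strand and $\nu,\nu'$ the incoming and outgoing arcs of the under strand. A positive crossing gives the two relations $\nu-\omega'-u\nu'+u\omega=0$ and $v\omega'-\omega=0$ (in this order); a negative crossing gives $\omega-\nu'-u\omega'+u\nu=0$ and $v\omega-\omega'=0$ (in this order). (If arcs coincide, coefficients are added.) The $2N'\times 2N'$ coefficient matrix (a consecutive pair of rows per crossing, columns indexed by the arcs in order) is the Alexander matrix, and $\Delta_0(D)(u,v)\in\mathbb{Z}[u,v]$ is its determinant. (The order of the crossings does not affect the determinant.) Virtual twist knot diagram $VT(a_1,\dots,a_n)$, for integers $a_i$. Two strands are twisted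 horizontally in $n$ blocks from left to right; block $i$ has $|a_i|$ classical crossings, all with the sign of $a_i$; consecutive blocks are separated by one virtual crossing; the ends are closed up by a clasp consisting of one classical and one virtual crossing. Put $N=\sum|a_i|$. The classical crossings are $c_1$ (clasp) and $c_2,\dots,c_{N+1}$ (the twist, left to right); the ordered arcs are $x_1,\dots,x_{2N+2}$. At $c_{k+1}$ ($1\le k\le N$) the odd strand passes from $x_{2k-1}$ to $x_{2k+1}$ and the even strand passes from $x_{2k+2}$ to $x_{2k}$. If $c_{k+1}$ is the $r$-th crossing of block $i$, it is of type 1 if $s(i-1)+r-1$ is even (an even number of classical and virtual crossings precede it in the twist) and of type 2 otherwise. In positive type 1 and negative type 2 crossings the even strand is over; in negative type 1 and positive type 2 crossings the odd strand is over. At $c_1$ the over strand passes from $x_2$ to $x_1$, the under strand passes from $x_{2N+1}$ to $x_{2N+2}$, and the sign is positive if $s(n)$ is even and negative if $s(n)$ is odd. For a diagram $D$ of a virtual knot, $(u-1)(v-1)(uv-1)$ divides $\Delta_0(D)(u,v)$ (Silver–Williams), and $\overline{\Delta}_0(D)$ denotes the quotient: $\Delta_0(D)=(u-1)(v-1)(uv-1)\overline{\Delta}_0(D)$. Polynomials here are those of the specific labeled diagrams, not normalized. Odd writhe. A classical crossing of a virtual knot diagram is odd if the path along the knot from the crossing back to itself goes through an odd number of classical crossings (counted with multiplicity, not counting the crossing itself). The odd writhe $OW$ is the sum of the signs of the odd classical crossings. *)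

(* Defs.v *)
From HB Require Import structures.
From mathcomp Require Import all_boot all_order all_algebra.
From mathcomp Require Import polyXY zify.

Set Implicit Arguments.
Unset Strict Implicit.
Unset Printing Implicit Defensive.

Import Order.TTheory GRing.Theory Num.Theory.
Local Open Scope ring_scope.

Record crossing (A : Type) := Crossing {
  positive : bool;
  over_in : A;
  over_out : A;
  under_in : A;
  under_out : A
}.

Definition sign (A : Type) (c : crossing A) : int :=
  if positive c then 1 else -1.

(* A strand of a diagram with m crossings is a pair (c, b): the over strand of
   c if b = true, its under strand if b = false. *)
Definition strand_in (A : Type) (m : nat) (f : 'I_m -> crossing A)
    (s : 'I_m * bool) : A :=
  if s.2 then over_in (f s.1) else under_in (f s.1).

Definition strand_out (A : Type) (m : nat) (f : 'I_m -> crossing A)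
    (s : 'I_m * bool) : A :=
  if s.2 then over_out (f s.1) else under_out (f s.1).

(* An oriented virtual link diagram with m classical crossings and 2m arcs,
   given by its incidence data.  Virtual crossings carry no data, since arcs
   run through them.  There are as many strands as arcs, so by injectivity each
   arc enters exactly one strand and leaves exactly one strand. *)
Record diagram (m : nat) := Diagram {
  crossings :> 'I_m -> crossing 'I_m.*2;
  strand_in_inj : injective (strand_in crossings);
  strand_out_inj : injective (strand_out crossings)
}.

(* The arc that follows x along the orientation.  The default case of the match
   never occurs. *)
Definition next_arc (m : nat) (D : diagram m) (x : 'I_m.*2) : 'I_m.*2 :=
  if [pick s | strand_in D s == x] is Some s then strand_out D s else x.

Definition is_knot (m : nat) (D : diagram m) : Prop :=
  forall x y, fconnect (next_arc D) x y.

Section AlexanderMatrix.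

Local Notation u := ('X : {poly {poly int}}).
Local Notation v := ('Y : {poly {poly int}}).

(* The relation as a row of coefficients; b selects the second relation. *)
Definition relation (n : nat) (c : crossing 'I_n) (b : bool) :
    'rV[{poly {poly int}}]_n :=
  let e x := delta_mx 0 x in
  let: Crossing pos w w' n n' := c in
  match pos, b with
  | true, false => e n - e w' - u *: e n' + u *: e w
  | true, true => v *: e w' - e w
  | false, false => e w - e n' - u *: e w' + u *: e n
  | false, true => v *: e w - e w'
  end.

Fact half_ord_subproof (m : nat) (i : 'I_m.*2) : (i./2 < m)%N.
Proof. by rewrite ltn_half_double. Qed.

Definition half_ord (m : nat) (i : 'I_m.*2) : 'I_m :=
  Ordinal (half_ord_subproof i).

(* Rows 2c and 2c+1 are the two relations of the crossing c. *)
Definition alexander_mx (m : nat) (D : diagram m) :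
    'M[{poly {poly int}}]_(m.*2) :=
  \matrix_(i < m.*2) relation (D (half_ord i)) (odd i).

Definition Delta0 (m : nat) (D : diagram m) : {poly {poly int}} :=
  \det (alexander_mx D).

Definition is_reduced_Delta0 (m : nat) (D : diagram m)
    (q : {poly {poly int}}) : Prop :=
  Delta0 D = (u - 1) * (v - 1) * (u * v - 1) * q.

Lemma is_reduced_Delta0_uniq (m : nat) (D : diagram m)
    (q q' : {poly {poly int}}) :
  is_reduced_Delta0 D q -> is_reduced_Delta0 D q' -> q = q'.
Proof.
rewrite /is_reduced_Delta0 => -> /mulfI; apply; rewrite !mulf_neq0 //.
- by rewrite -size_poly_eq0 size_XsubC.
- by rewrite -polyC1 -polyCB polyC_eq0 -size_poly_eq0 size_XsubC.
apply/eqP => /(congr1 (fun p : {poly {poly int}} => p.[0, 0])).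
by rewrite /= !hornerE.
Qed.

End AlexanderMatrix.

(* Meant for knots.  [findex f x y] is the number of steps from x to y, and
   each step along the knot goes through one crossing.  The path starts on the
   over strand of c and returns on its under strand.  The other path from c to
   itself goes through a number of crossings of the same parity: the two
   numbers add up to 2m - 2. *)
Definition odd_crossing (m : nat) (D : diagram m) (c : 'I_m) : bool :=
  odd (findex (next_arc D) (over_out (D c)) (under_in (D c))).

Definition odd_writhe (m : nat) (D : diagram m) : int :=
  \sum_(c < m | odd_crossing D c) sign (D c).

Definition parity (k : int) : int := (k %% 2)%Z.

(* The integers a_1, ..., a_n are the entries a`_0, ..., a`_(n-1) of a. *)
Definition psum (a : seq int) (i : nat) : int := \sum_(j < i) (a`_j + 1).

Definition delta (a : seq int) : int :=
  \sum_(j < size a) parity a`_j * parity (psum a j.+1).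

Definition ncross (a : seq int) : nat := (\sum_(x <- a) `|x|)%N.

(* The crossings of the twist from left to right: (i, r) is the crossing number
   r of the block number i, both counted from 0. *)
Definition twist (a : seq int) : seq (nat * nat) :=
  [seq (i, r) | i <- iota 0 (size a), r <- iota 0 `|a`_i|].

(* The arc x_j, for 1 <= j <= 2N + 2. *)
Definition VT_arc (a : seq int) (j : nat) : 'I_(ncross a).+1.*2 := inord j.-1.

(* The crossing 0 is the clasp.  At the others the even strand is over exactly
   when the crossing is positive of type 1 or negative of type 2. *)
Definition VT_crossing (a : seq int) (k : 'I_(ncross a).+1) :
    crossing 'I_(ncross a).+1.*2 :=
  let N := ncross a in
  let x := VT_arc a in
  if k == 0%N :> nat then
    Crossing (parity (psum a (size a)) == 0)
      (x 2%N) (x 1%N) (x (2 * N + 1)%N) (x (2 * N + 2)%N)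
  else
    let: (i, r) := nth (0, 0)%N (twist a) k.-1 in
    let pos := 0 < a`_i in
    let type1 := parity (psum a i + r%:Z) == 0 in
    if pos == type1 then
      Crossing pos (x (2 * k + 2)%N) (x (2 * k)%N)
        (x (2 * k - 1)%N) (x (2 * k + 1)%N)
    else
      Crossing pos (x (2 * k - 1)%N) (x (2 * k + 1)%N)
        (x (2 * k + 2)%N) (x (2 * k)%N).

Lemma VT_crossingP (a : seq int) (k : 'I_(ncross a).+1) :
  let N := ncross a in
  let x := VT_arc a in
  exists b : bool, forall s : bool,
    if k == 0%N :> nat then
      strand_in (@VT_crossing a) (k, s) = (if s then x 2%N else x (2 * N + 1)%N) /\
      strand_out (@VT_crossing a) (k, s) = (if s then x 1%N else x (2 * N + 2)%N)
    else
      strand_in (@VT_crossing a) (k, s) =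
        (if s == b then x (2 * k + 2)%N else x (2 * k - 1)%N) /\
      strand_out (@VT_crossing a) (k, s) =
        (if s == b then x (2 * k)%N else x (2 * k + 1)%N).
Proof.
rewrite /strand_in /strand_out /VT_crossing /=.
case: eqP => _; first by exists true; case.
case: (nth _ _ _) => i r; case: ifP => _.
  by exists true; case.
by exists false; case.
Qed.

Lemma VT_arcE (a : seq int) (j : nat) :
  (0 < j <= 2 * ncross a + 2)%N -> VT_arc a j = j.-1 :> nat.
Proof.
move=> hj; have : (j.-1 < (ncross a).+1.*2)%N by lia.
exact: inordK.
Qed.

Lemma VT_arc_inj (a : seq int) (i j : nat) : VT_arc a i = VT_arc a j ->
  (0 < i <= 2 * ncross a + 2)%N -> (0 < j <= 2 * ncross a + 2)%N -> i = j.
Proof.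
by move=> /(congr1 (@nat_of_ord _)) + hi hj; rewrite !VT_arcE //; lia.
Qed.

Lemma VT_in_inj (a : seq int) : injective (strand_in (@VT_crossing a)).
Proof.
move=> [k s] [l t].
have hk := ltn_ord k; have hl := ltn_ord l.
case: (eqVneq k l) => [<-|neq].
  have [b Hb] := VT_crossingP k.
  move: (Hb s) (Hb t); case: ifP => k0 [-> _] [-> _];
    by case: s t b {Hb} => [] [] [] //= /VT_arc_inj H; exfalso; lia.
have {}neq : (k != l :> nat) by [].
have [b /(_ s)] := VT_crossingP k; have [d /(_ t)] := VT_crossingP l.
case: ifP => l0 [-> _]; case: ifP => k0 [-> _];
  by case: s (s == b) t (t == d) => [] [] [] [] //= /VT_arc_inj H; exfalso; lia.
Qed.

Lemma VT_out_inj (a : seq int) : injective (strand_out (@VT_crossing a)).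
Proof.
move=> [k s] [l t].
have hk := ltn_ord k; have hl := ltn_ord l.
case: (eqVneq k l) => [<-|neq].
  have [b Hb] := VT_crossingP k.
  move: (Hb s) (Hb t); case: ifP => k0 [_ ->] [_ ->];
    by case: s t b {Hb} => [] [] [] //= /VT_arc_inj H; exfalso; lia.
have {}neq : (k != l :> nat) by [].
have [b /(_ s)] := VT_crossingP k; have [d /(_ t)] := VT_crossingP l.
case: ifP => l0 [_ ->]; case: ifP => k0 [_ ->];
  by case: s (s == b) t (t == d) => [] [] [] [] //= /VT_arc_inj H; exfalso; lia.
Qed.

Definition VT (a : seq int) : diagram (ncross a).+1 :=
  Diagram (@VT_in_inj a) (@VT_out_inj a).

Section KnotDiagrams.

Variables (m : nat) (D : diagram m).

Lemma next_strand_in s : next_arc D (strand_in D s) = strand_out D s.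
Proof.
rewrite /next_arc; case: pickP => [t /eqP/strand_in_inj->//|].
by move/(_ s); rewrite eqxx.
Qed.

Lemma strand_in_onto x : exists s, strand_in D s = x.
Proof.
suff le_card : (#|'I_m.*2| <= #|{: 'I_m * bool}|)%N.
  by have /codomP[s ->] := inj_card_onto (@strand_in_inj m D) le_card x; exists s.
by rewrite card_prod !card_ord card_bool muln2.
Qed.

Lemma next_arc_inj : injective (next_arc D).
Proof.
move=> x y; have [s <-] := strand_in_onto x; have [t <-] := strand_in_onto y.
by rewrite !next_strand_in => /strand_out_inj->.
Qed.

End KnotDiagrams.

Lemma VT_knot (a : seq int) : is_knot (VT a).
Proof.
set N := ncross a; set x := VT_arc a.
have symf := fconnect_sym (@next_arc_inj _ (VT a)).
have next s := next_strand_in (VT a) s.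
have n0 s : next_arc (VT a) (if s then x 2%N else x (2 * N + 1)%N) =
            if s then x 1%N else x (2 * N + 2)%N.
  have [b /(_ s)/= [<- <-]] := @VT_crossingP a ord0; exact: next.
have nS (k : nat) (b : bool) : (0 < k <= N)%N ->
    next_arc (VT a) (if b then x (2 * k + 2)%N else x (2 * k - 1)%N) =
    if b then x (2 * k)%N else x (2 * k + 1)%N.
  move=> /andP[k0 kN]; have [d /(_ (b == d))/=] := @VT_crossingP a (inord k).
  rewrite inordK // (negPf (_ : k != 0)%N) -?lt0n // (_ : (b == d) == d = b).
    by case=> [<- <-]; apply: next.
  by case: b d => [] [].
have codd k : (k <= N)%N -> fconnect (next_arc (VT a)) (x 1%N) (x (2 * k + 1)%N).
  elim: k => [|k IH] kN; first exact: connect0.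
  apply: (connect_trans (IH (ltnW kN))); apply/connect1/eqP.
  have /= := nS k.+1 false; rewrite kN => /(_ isT) <-.
  by congr (next_arc _ (x _)); lia.
have ceven k : (k <= N)%N ->
    fconnect (next_arc (VT a)) (x 1%N) (x (2 * k + 2)%N).
  elim: k => [|k IH] kN.
    by rewrite symf; apply/connect1/eqP; apply: (n0 true).
  apply: (connect_trans (IH (ltnW kN))); rewrite symf; apply/connect1/eqP.
  have /= := nS k.+1 true; rewrite kN => /(_ isT) ->.
  by congr (x _); lia.
have cx y : fconnect (next_arc (VT a)) (x 1%N) y.
  have hy := ltn_ord y.
  have -> : y = x y.+1 by apply: val_inj; rewrite /= VT_arcE //; lia.
  have := odd_double_half y; case: (odd y) => /= e.
    by have -> : (y.+1 = 2 * y./2 + 2)%N by [lia]; apply: ceven; lia.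
  by have -> : (y.+1 = 2 * y./2 + 1)%N by [lia]; apply: codd; lia.
by move=> y z; apply: (connect_trans _ (cx z)); rewrite symf.
Qed.

(* Main.v *)
Require Import Defs.
From HB Require Import structures.
From mathcomp Require Import all_boot all_order all_algebra.
From mathcomp Require Import polyXY zify ring.

Set Implicit Arguments.
Unset Strict Implicit.
Unset Printing Implicit Defensive.

Import Order.TTheory GRing.Theory Num.Theory.
Local Open Scope ring_scope.

(** The value of the Alexander matrix at a labelling of the arcs by ring elements
    lists the failures of the two relations at every crossing.  A crossing of
    the twist relates the pair of arcs (p, q) on its left to the pair (p', q')
    on its right and determines the second pair from the first, so, after
    clearing denominators, an initial pair (p, q) extends to a labelling
    [arc_value] that satisfies all the relations of the twist.  If moreover
    (p, q) is proportional to (1, v) or (v, 1), according to the sign of the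
    clasp, the second relation of the clasp holds as well, and Cramer's rule
    ([det_mul_col0]) expresses Delta0 through the one remaining value, that of
    the first relation of the clasp, and the minor without the first row and the
    first column.  This minor is block triangular, with one block of size 1 from
    the clasp and one of size 2 for each crossing of the twist ([VT_minor]).

    The transfer matrices of all the crossings have a common eigenvector (1, 1)
    and a common eigenform p - q.  Hence the composite transfer matrix is known
    up to one coefficient on each strand, [odd_coef] and [even_coef], which
    satisfy linear recursions.  The first relation of the clasp then takes the
    value
      (u - 1) (v - 1) (u v - 1) w,
    where w is even_coef + g for a positive clasp and odd_coef - g for a negative
    one.  The polynomial g comes from a difference that vanishes at u = 1
    ([clasp_value_div]), and this same factorization shows, without passing to a
    limit, that 2 g = odd_coef - even_coef - (N mod 2) at (-1, -1), where N is the
    number of crossings of the twist.  Hence 2 w involves the two coefficients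
    only through their sum, which at (-1, -1) is minus the sum of the signs of
    the twist ([coefD_at]).  The result is [VT_reduced_Delta0].

    On the other side, all the crossings of the twist are odd, and the clasp is
    odd exactly when N is odd ([odd_writhe_VT]), so both sides agree up to sign.
    The minor contributes -1 to the power of the number of crossings of type 2,
    which is delta plus the sum of the floors of |a_i| / 2 ([type2_count_VT]), and
    the clasp contributes its own sign, -1 to the power s(n). *)

(** * Determinants *)

Section Determinants.

Variable R : comNzRingType.

(** Entries are indexed by natural numbers so that passing to a minor amounts to
    shifting the indices. *)
Definition nat_mx (m : nat) (F : nat -> nat -> R) : 'M[R]_m :=
  \matrix_(i < m, j < m) F i j.

(** The first entry of the identity \adj M *m (M *m x) = \det M *: x, in which
    only one entry of M *m x survives. *)
Lemma det_mul_col0 (m : nat) (M : 'M[R]_m.+1) (x : 'cV[R]_m.+1) :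
    (forall i, i != 0 -> (M *m x) i 0 = 0) ->
  \det M * x 0 0 = (M *m x) 0 0 * \det (row' 0 (col' 0 M)).
Proof.
move=> Mx0; have /matrixP/(_ 0 0) : \adj M *m (M *m x) = \det M *: x.
  by rewrite mulmxA mul_adj_mx mul_scalar_mx.
rewrite [RHS]mxE => <-; rewrite mxE (bigD1 0) //= big1 => [|i i0].
  by rewrite addr0 mulrC !mxE /cofactor addn0 expr0 mul1r.
by rewrite Mx0 ?mulr0.
Qed.

Lemma det_first_row (m : nat) (F : nat -> nat -> R) :
    (forall j, (0 < j)%N -> F 0%N j = 0) ->
  \det (nat_mx m.+1 F) = F 0%N 0%N * \det (nat_mx m (fun i j => F i.+1 j.+1)).
Proof.
move=> F0; rewrite (expand_det_row _ 0) (bigD1 0) //= big1 => [|j j0]; last first.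
  by rewrite mxE F0 ?mul0r // lt0n.
rewrite addr0 mxE /cofactor addn0 expr0 mul1r; congr (_ * \det _).
by apply/matrixP=> i j; rewrite !mxE.
Qed.

Lemma det_block2 (m : nat) (F : nat -> nat -> R) :
    (forall i j, (i./2 < j./2)%N -> F i j = 0) ->
  \det (nat_mx m.*2 F) = \prod_(k < m)
    (F k.*2 k.*2 * F k.*2.+1 k.*2.+1 - F k.*2 k.*2.+1 * F k.*2.+1 k.*2).
Proof.
elim: m F => [|m IH] F F0; first by rewrite big_ord0 det_mx00.
pose G i j := F i.+2 j.+2.
have -> : nat_mx m.+1.*2 F =
    block_mx (nat_mx 2 F) 0 (\matrix_(i, j) F i.+2 j) (nat_mx m.*2 G).
  apply/matrixP => i j; rewrite [RHS]mxE [LHS]mxE.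
  case: splitP => i' ->; rewrite mxE; case: splitP => j' ->; rewrite mxE //.
  by apply: F0; case: i' => [[|[|]]].
rewrite (@det_lblock _ 2 m.*2) big_ord_recl IH => [|i j ij]; last exact: F0.
congr (_ * _); rewrite (expand_det_row _ 0) !big_ord_recl big_ord0 /cofactor.
rewrite !det_mx11 !mxE /=; ring.
Qed.

Lemma minor_nat_mx (m : nat) (F : nat -> nat -> R) :
  row' 0 (col' 0 (nat_mx m.+1 F)) = nat_mx m (fun i j => F i.+1 j.+1).
Proof. by apply/matrixP=> i j; rewrite !mxE. Qed.

End Determinants.

(** * The relations of the twist knot diagrams *)

Local Notation u := ('X : {poly {poly int}}).
Local Notation v := ('Y : {poly {poly int}}).
Local Notation poly2 := {poly {poly int}}.

(** Allowing an arbitrary type of arcs, here the natural numbers, frees the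
    relations from the bounds on the labels of the arcs. *)
Definition relation_value (A : Type) (c : crossing A) (b : bool)
    (x : A -> poly2) : poly2 :=
  let: Crossing pos w w' n n' := c in
  match pos, b with
  | true, false => x n - x w' - u * x n' + u * x w
  | true, true => v * x w' - x w
  | false, false => x w - x n' - u * x w' + u * x n
  | false, true => v * x w - x w'
  end.

Lemma relationE (n : nat) (c : crossing 'I_n) (b : bool) (x : 'I_n -> poly2) :
  (relation c b *m \col_j x j) 0 0 = relation_value c b x.
Proof.
have e j : (delta_mx 0 j : 'rV[poly2]_n) *m \col_j x j = (x j)%:M.
  by rewrite -rowE; apply/matrixP=> i k; rewrite !ord1 !mxE.
case: c b => [[] w w' m m'] [] /=;
  by rewrite ?(mulmxBl, mulmxDl, mulNmx, =^~ scalemxAl) !e !mxE eqxx !mulr1n.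
Qed.

Lemma relation_coef (n : nat) (c : crossing 'I_n) (b : bool) (j : 'I_n) :
  relation c b 0 j = relation_value c b (fun i => (i == j)%:R).
Proof.
rewrite -relationE (_ : \col_i _ = delta_mx j 0); last first.
  by apply/colP=> i; rewrite !mxE eqxx andbT.
by rewrite -colE mxE.
Qed.

(** In [clasp_crossing] the first pair of arcs consists of x_1 and x_2, the second
    one of x_(2N+1) and x_(2N+2).  In [twist_crossing] the two pairs lie to the
    left and to the right of the crossing; p and p' lie on the odd strand, q and
    q' on the even strand. *)
Definition clasp_crossing (A : Type) (pos : bool) (p q p' q' : A) :=
  Crossing pos q p p' q'.

Definition twist_crossing (A : Type) (pos type1 : bool) (p q p' q' : A) :=
  if pos == type1 then Crossing pos q' q p p' else Crossing pos p p' q' q.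

Section Twist.

Variable a : seq int.
Let N := ncross a.

Definition twist_pos (k : nat) : bool := 0 < a`_(nth (0, 0)%N (twist a) k).1.

Definition twist_type1 (k : nat) : bool :=
  let: (i, r) := nth (0, 0)%N (twist a) k in parity (psum a i + r%:Z) == 0.

Definition clasp_pos : bool := parity (psum a (size a)) == 0.

(** The arc x_j has index j - 1, so the odd strand carries the even indices and
    conversely. *)
Definition VT_relation (k : nat) (b : bool) (x : nat -> poly2) : poly2 :=
  relation_value
    (if k is k'.+1 then
       twist_crossing (twist_pos k') (twist_type1 k')
         k'.*2 k'.*2.+1 k.*2 k.*2.+1
     else clasp_crossing clasp_pos 0%N 1%N N.*2 N.*2.+1) b x.

Lemma VT_relationE (k : 'I_N.+1) (b : bool) (x : nat -> poly2) :
  relation_value (VT a k) b (fun i => x i) = VT_relation k b x.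
Proof.
have hk := ltn_ord k.
rewrite /VT_relation /= /VT_crossing; case: (nat_of_ord k) hk => [|k'] hk /=.
  rewrite /clasp_crossing -/clasp_pos.
  by case: clasp_pos b => [] [] /=; rewrite !VT_arcE //= -?/N;
    do ?congr (_ + _); do ?congr (- _); do ?congr (_ * _); do ?congr (x _); lia.
rewrite /twist_pos /twist_type1 /twist_crossing.
case: (nth _ _ _) => i r /=; case: ifP => _; case: (0 < a`_i) b => [] [] /=;
  by rewrite !VT_arcE //= -?/N; do ?congr (_ + _);
    do ?congr (- _); do ?congr (_ * _); do ?congr (x _); lia.
Qed.

Lemma alexander_mulE (x : nat -> poly2) (i : 'I_N.+1.*2) :
  (alexander_mx (VT a) *m \col_j x j) i 0 = VT_relation i./2 (odd i) x.
Proof.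
rewrite -(VT_relationE (half_ord i)) -relationE.
rewrite (_ : relation _ _ = row i (alexander_mx (VT a))); last by rewrite rowK.
by rewrite -row_mul [RHS]mxE.
Qed.

Lemma alexander_natE : alexander_mx (VT a) =
  nat_mx _ (fun i j => VT_relation i./2 (odd i) (fun l => (l == j)%:R)).
Proof.
apply/matrixP=> i j; rewrite !mxE relation_coef.
exact: (VT_relationE (half_ord i) (odd i) (fun l => (l == j)%:R)).
Qed.

End Twist.

(** * Solving the relations of the twist *)

Section Transfer.

Variables (pos type1 : nat -> bool).

Definition type1_count (k : nat) : nat := \sum_(j < k) type1 j.
Definition type2_count (k : nat) : nat := \sum_(j < k) ~~ type1 j.

Lemma type_countD (k : nat) : (type1_count k + type2_count k)%N = k.
Proof.
rewrite -big_split /= -[RHS]card_ord -sum1_card.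
by apply: eq_bigr => j _; case: (type1 j).
Qed.

(** For type 1 crossings u times the transfer matrix, and for type 2 crossings v
    times it, has polynomial entries.  The composite of the first k of these
    matrices acts on (1, 1) as (u v)^t1 and on the form p - q as (u v)^t2, where
    t1 and t2 count the crossings of either type.  It therefore sends (p, q) to
      (u v)^t1 (p, q) + (p - q) w
    for a single vector w, and w = (u v - 1) (odd_coef k, even_coef k).  A
    crossing only rescales the coefficient of its over strand, which is the even
    one when its sign and its type agree; the increment goes to the under
    strand. *)
Fixpoint odd_coef (k : nat) : poly2 :=
  if k is k'.+1 then
    (if type1 k' then u * v else 1) * odd_coef k' -
    (if pos k' == type1 k'
     then (-1) ^+ (~~ type1 k') * (u * v) ^+ type2_count k' else 0)
  else 0.

Fixpoint even_coef (k : nat) : poly2 :=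
  if k is k'.+1 then
    (if type1 k' then u * v else 1) * even_coef k' +
    (if pos k' == type1 k' then 0
     else (-1) ^+ (~~ type1 k') * (u * v) ^+ type2_count k')
  else 0.

Lemma type1_countS k : type1_count k.+1 = (type1_count k + type1 k)%N.
Proof. exact: big_ord_recr. Qed.

Lemma type2_countS k : type2_count k.+1 = (type2_count k + ~~ type1 k)%N.
Proof. exact: big_ord_recr. Qed.

(** The action on the form p - q, whose eigenvalue is (u v)^t2. *)
Lemma coefB (k : nat) : (u * v - 1) * (odd_coef k - even_coef k) =
  (u * v) ^+ type2_count k - (u * v) ^+ type1_count k.
Proof.
elim: k => [|k IH].
  by rewrite /= /type1_count /type2_count !big_ord0; ring.
have {IH} E : (u * v) ^+ type1_count k = (u * v) ^+ type2_count k -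
  (u * v - 1) * (odd_coef k - even_coef k) by rewrite IH; ring.
rewrite type1_countS type2_countS /=; case: (type1 k) => /=;
  rewrite addn0 addn1 !exprS E; case: (pos k) => /=;
  rewrite ?expr0; move: (_ ^+ _) => beta; ring.
Qed.

Definition twist_scale (k : nat) : poly2 := if type1 k then u else v.

Variables (N : nat) (p q : poly2).

(** The product compensates for the denominators that the crossings still to come
    introduce: the transfer matrices to the left of the arc are rescaled, those
    to its right enter only through their scales. *)
Definition arc_value (i : nat) : poly2 :=
  (\prod_(i./2 <= j < N) twist_scale j) *
  ((u * v) ^+ type1_count i./2 * (if odd i then q else p) +
   (u * v - 1) * (p - q) *
     (if odd i then even_coef i./2 else odd_coef i./2)).

Lemma arc_value_odd k : arc_value k.*2.+1 = (\prod_(k <= j < N) twist_scale j) *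
  ((u * v) ^+ type1_count k * q + (u * v - 1) * (p - q) * even_coef k).
Proof. by rewrite /arc_value /= odd_double uphalf_double. Qed.

Lemma arc_value_even k : arc_value k.*2 = (\prod_(k <= j < N) twist_scale j) *
  ((u * v) ^+ type1_count k * p + (u * v - 1) * (p - q) * odd_coef k).
Proof. by rewrite /arc_value /= odd_double doubleK. Qed.

Lemma arc_value_twist (k : nat) (b : bool) : (k < N)%N ->
  relation_value
    (twist_crossing (pos k) (type1 k) k.*2 k.*2.+1 k.+1.*2 k.+1.*2.+1)
    b arc_value = 0.
Proof.
move=> kN; have E : (u * v) ^+ type2_count k = (u * v) ^+ type1_count k +
  (u * v - 1) * (odd_coef k - even_coef k) by rewrite coefB; ring.
rewrite /twist_crossing.
case pk: (pos k); case tk: (type1 k); case: b;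
  rewrite /relation_value ?eqxx /= -?doubleS !(arc_value_odd, arc_value_even);
  rewrite (big_ltn kN) type1_countS /= /twist_scale pk tk /= ?E ?addn0 ?addn1;
  rewrite ?exprS ?expr0; move: (_ ^+ type1_count k) => alpha; ring.
Qed.

End Transfer.

(** * The determinant in terms of the clasp *)

Section Minor.

Variable a : seq int.
Let N := ncross a.
Let pos := twist_pos a.
Let type1 := twist_type1 a.

(** Without the first relation of the clasp nothing links the left end of the
    twist to the right end: each crossing involves only its own arcs on the
    right and earlier ones.  The second relation of the clasp contributes its
    coefficient at x_2, and each crossing the determinant of its relations in
    its two arcs on the right, u for type 1 and -v for type 2. *)
Lemma VT_minor : \det (row' 0 (col' 0 (alexander_mx (VT a)))) =
  (if clasp_pos a then -1 else v) *
  ((-1) ^+ type2_count type1 N * \prod_(0 <= j < N) twist_scale type1 j).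
Proof.
rewrite alexander_natE minor_nat_mx det_first_row => [|j j0]; last first.
  by rewrite /VT_relation /=; case: (clasp_pos a) => /=;
    rewrite (_ : 1 == j.+1 = false)%N ?mulr0 ?subr0 //; lia.
rewrite det_block2 => [|i j ij]; last first.
  have jh := odd_double_half j.
  have x0 l : (l < i./2.*2.+4)%N -> (l == j.+2)%:R = 0 :> poly2.
    by move=> lj; rewrite (_ : _ == _ = false) //; lia.
  rewrite /VT_relation /= negbK /twist_crossing.
  by case: ifP => _; case: (twist_pos _ _); case: (odd i) => /=;
    rewrite !x0 ?(mulr0, subr0, addr0) //; lia.
congr (_ * _).
  by rewrite /VT_relation /=; case: (clasp_pos a);
    rewrite /= ?mulr0 ?mulr1 ?subr0 ?sub0r.
rewrite /type2_count -prodrXr big_mkord -big_split /=; apply: eq_bigr => k _.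
rewrite /VT_relation /= odd_double /= uphalf_double doubleK.
rewrite /twist_crossing /twist_scale -/pos -/type1 doubleS.
have d1 l : (l == l.+1 = false) * (l.+1 == l = false) by split; lia.
have d2 l : (l == l.+2 = false) * (l.+2 == l = false) by split; lia.
have d3 l : (l == l.+3 = false) * (l.+3 == l = false) by split; lia.
case: (pos k); case: (type1 k) => /=; rewrite !(eqxx, d1, d2, d3) /=; ring.
Qed.

Lemma VT_Delta0_arc_value (p q : poly2) :
    VT_relation a 0 true (arc_value pos type1 N p q) = 0 ->
  Delta0 (VT a) * (p * \prod_(0 <= j < N) twist_scale type1 j) =
  VT_relation a 0 false (arc_value pos type1 N p q) *
  \det (row' 0 (col' 0 (alexander_mx (VT a)))).
Proof.
move=> clasp0; set x := arc_value pos type1 N p q.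
have mulE := alexander_mulE x.
have := @det_mul_col0 _ _ (alexander_mx (VT a)) (\col_j x j).
rewrite mulE /= mxE /Delta0 => <-; last first.
  move=> i i0; rewrite mulE.
  have i0' : (i != 0 :> nat)%N by [].
  have := @half_ord_subproof N.+1 i; have := odd_double_half i.
  case: (i./2) => [|k] iE kN; last exact: arc_value_twist.
  by case: (odd i) iE => // iE; case/eqP: i0'; rewrite -iE.
congr (_ * _).
have -> : x 0%N = _ := arc_value_even pos type1 N p q 0.
by rewrite /type1_count big_ord0 /=; ring.
Qed.

End Minor.

(** * Divisibility and the value at (-1, -1) *)

Section Reduced.

Variables (pos type1 : nat -> bool).
Let t1 := type1_count type1.
Let t2 := type2_count type1.

Lemma prod_twist_scale (k : nat) :
  \prod_(0 <= j < k) twist_scale type1 j = u ^+ t1 k * v ^+ t2 k.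
Proof.
elim: k => [|k IH].
  by rewrite big_nil /t1 /t2 /type1_count /type2_count !big_ord0 !expr0 mulr1.
rewrite big_nat_recr //= IH /t1 /t2 type1_countS type2_countS /twist_scale.
by case: (type1 k); rewrite /= addn0 addn1 exprS; ring.
Qed.

(** At (-1, -1) every power of u v is 1, and the sign of each increment is minus
    the sign of the crossing, whichever coefficient it is added to. *)
Lemma coefD_at (k : nat) :
  (odd_coef pos type1 k + even_coef pos type1 k).[-1, -1] =
  - \sum_(j < k) (if pos j then 1 else -1).
Proof.
elim: k => [|k IH]; first by rewrite big_ord0 /= addr0 !hornerC oppr0.
rewrite big_ord_recr opprD -IH /=.
case: (pos k); case: (type1 k) => /=;
  rewrite !hornerE /= mulrNN mulr1 expr1n; ring.
Qed.

(** The quotient h is a polynomial in v alone, and the factor v - 1, which is -2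
    at v = -1, lets its value there be read off the left-hand side. *)
Lemma type_powers_div (k : nat) : exists2 h : {poly int},
  v ^+ t2 k - v ^+ t1 k = (v - 1) * h%:P &
  2 * (-1) ^+ t1 k * h.[-1] = 1 - (-1) ^+ k.
Proof.
pose s n := \sum_(i < n) ('X : {poly int}) ^+ i.
have E n : 'X ^+ n - 1 = ('X - 1) * s n by apply: subrX1.
have {}E : 'X ^+ t2 k - 'X ^+ t1 k =
    ('X - 1) * (s (t2 k) - s (t1 k)).
  by rewrite mulrBr -!E; ring.
exists (s (t2 k) - s (t1 k)).
  by rewrite -!polyC_exp -polyCB E polyCM polyCB.
have := congr1 (fun p => p.[-1]) E; rewrite /= !hornerE.
rewrite -[in (-1) ^+ k](type_countD type1 k) exprD -/t1 -/t2 => Eh.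
transitivity (- (-1) ^+ t1 k *
    ((-1) ^+ t2 k - (-1) ^+ t1 k) : int).
  by rewrite Eh; ring.
by rewrite -[X in _ = X - _](sqrr_sign _ (t1 k)); ring.
Qed.

(** The left-hand side is what the first relation of the clasp amounts to, apart
    from terms that are visibly divisible.  The factor u v - 1 is explicit,
    [type_powers_div] provides v - 1, and the factor u - 1 results from the
    vanishing of the cofactor r at u = 1, which [coefB] gives after
    multiplication by (v - 1) ^ 2. *)
Lemma clasp_value_div (k : nat) : exists2 g : poly2,
  (u * v - 1) * (u ^+ t1 k * v ^+ t2 k - (u * v) ^+ t1 k) +
  (1 - v) * (u * v - 1) * (odd_coef pos type1 k - even_coef pos type1 k) =
    (u - 1) * (v - 1) * (u * v - 1) * g &
  2 * g.[-1, -1] =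
    (odd_coef pos type1 k - even_coef pos type1 k).[-1, -1] - (odd k)%:R.
Proof.
have [h hE h1] := type_powers_div k.
set gam := odd_coef pos type1 k - even_coef pos type1 k.
pose r := u ^+ t1 k * h%:P - gam.
have rE : (v - 1) * (u * v - 1) * r =
    (u * v - 1) * (u ^+ t1 k * v ^+ t2 k - (u * v) ^+ t1 k) +
    (1 - v) * (u * v - 1) * gam.
  transitivity
    ((u * v - 1) * (u ^+ t1 k * ((v - 1) * h%:P) - (v - 1) * gam)).
    by rewrite /r; ring.
  by rewrite -hE !exprMn; ring.
have r1 : root r 1.
  have nz : ('X - 1 : {poly int}) != 0 by rewrite -polyC1 polyXsubC_eq0.
  apply/rootP/(mulfI nz)/(mulfI nz).
  have := rE; rewrite -(mulrA (1 - v)) coefB => /(congr1 (fun p => p.[1])).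
  (* At u = 1 the factor u v - 1 becomes v - 1. *)
  rewrite /= !hornerE /= => ->.
  by rewrite expr1n; ring.
have [g gE] := factor_theorem _ _ r1; exists g.
  by rewrite -rE gE polyC1; ring.
(* The factor u - 1 is -2 at u = -1, whence the factor 2 in front of g. *)
have := congr1 (fun p => p.[-1, -1]) gE; rewrite /r /= !hornerE => rg.
suff hodd : (-1) ^+ t1 k * h.[-1] = (odd k)%:R.
  transitivity (- (g.[-1, -1] * (-1 - 1))); first by ring.
  by rewrite -rg hodd; ring.
move: h1; rewrite -mulrA -(signr_odd _ k); move: (_ * h.[-1]) => x.
by case: (odd k); rewrite ?expr0 ?expr1; lia.
Qed.

End Reduced.

Section Assembly.

Variable a : seq int.
Let N := ncross a.
Let pos := twist_pos a.
Let type1 := twist_type1 a.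

Lemma VT_reduced_Delta0 : exists q : poly2, is_reduced_Delta0 (VT a) q /\
  2 * q.[-1, -1] =
    (-1) ^+ type2_count type1 N * (if clasp_pos a then 1 else -1) *
     (\sum_(k < N) (if pos k then 1 else -1) +
      (odd N)%:R * (if clasp_pos a then 1 else -1)).
Proof.
have [g gE g1] := clasp_value_div pos type1 N.
pose eps : poly2 := if clasp_pos a then 1 else -1.
(* The second relation of the clasp is v p = q or v q = p. *)
pose p := if clasp_pos a then 1 else v; pose q := if clasp_pos a then v else 1.
pose w :=
  if clasp_pos a then even_coef pos type1 N + g else odd_coef pos type1 N - g.
have x_0 p' q' : arc_value pos type1 N p' q' 0 = _ :=
  arc_value_even pos type1 N p' q' 0.
have x_1 p' q' : arc_value pos type1 N p' q' 1 = _ :=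
  arc_value_odd pos type1 N p' q' 0.
have t10 : type1_count type1 0 = 0%N by rewrite /type1_count big_ord0.
have K0 : VT_relation a 0 true (arc_value pos type1 N p q) = 0.
  by rewrite /VT_relation /p /q; case: (clasp_pos a);
    rewrite /= x_0 x_1 t10; ring.
have fE : VT_relation a 0 false (arc_value pos type1 N p q) =
    (u - 1) * (v - 1) * (u * v - 1) * w.
  transitivity (eps * ((u - 1) * (v - 1) * (u * v - 1) * g) +
    (u - 1) * (v - 1) * (u * v - 1) * (w - eps * g)); last by ring.
  rewrite -gE -prod_twist_scale /VT_relation /=.
  rewrite /w /eps /p /q; case: (clasp_pos a); rewrite /= x_0 x_1 t10
    arc_value_even arc_value_odd !(big_geq (leqnn N)) /=; ring.
have := VT_Delta0_arc_value K0; rewrite VT_minor -/pos -/type1 -/N fE => H.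
exists (- eps * (-1) ^+ type2_count type1 N * w); split.
  have cN0 : p * \prod_(0 <= j < N) twist_scale type1 j != 0.
    rewrite prod_twist_scale !mulf_neq0 ?expf_neq0 ?polyX_eq0 //.
      rewrite /p; case: (clasp_pos a); first by rewrite oner_eq0.
      by rewrite polyC_eq0 polyX_eq0.
    by rewrite polyC_eq0 polyX_eq0.
  apply: (mulIf cN0); rewrite H.
  by rewrite /p /eps; case: (clasp_pos a); ring.
have := coefD_at pos type1 N; move: g1; rewrite !hornerE => g1 /(congr1 -%R).
rewrite opprK => <-; rewrite /w /eps.
case: (clasp_pos a); rewrite !hornerE /=.
  transitivity (- (-1) ^+ type2_count type1 N *
    (2 * (even_coef pos type1 N).[-1, -1] + 2 * g.[-1, -1]) : int).
    by ring.
  by rewrite g1; ring.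
transitivity ((-1) ^+ type2_count type1 N *
  (2 * (odd_coef pos type1 N).[-1, -1] - 2 * g.[-1, -1]) : int).
  by ring.
by rewrite g1; ring.
Qed.

End Assembly.

(** * Parities, the odd writhe and the sign *)

Lemma parityE x : parity x = (odd `|x|%N)%:Z.
Proof. rewrite /parity; lia. Qed.

Lemma odd_abszD (x y : int) : odd `|(x + y)%R| = odd `|x| (+) odd `|y|.
Proof. lia. Qed.

Lemma sum_odd_shift (s m : nat) :
  (\sum_(r < m) odd (s + r) = m./2 + (odd m && odd s))%N.
Proof.
elim: m => [|m IH]; first by rewrite big_ord0.
rewrite big_ord_recr /= IH oddD uphalf_half.
by case: (odd m); case: (odd s) => /=; lia.
Qed.

Lemma exprN1_parity (x : int) :
  (-1) ^ x = (if parity x == 0 then 1 else -1) :> int.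
Proof.
rewrite parityE; case: x => n /=; rewrite ?exprnP.
  by rewrite -exprnP -signr_odd; case: (odd n).
rewrite NegzE -exprnN -signr_odd /=.
by case: (odd n).
Qed.

Section Writhe.

Variable a : seq int.
Let N := ncross a.
Let next := next_arc (VT a).

(** The arcs x_(2k) and x_(2k+1), of indices 2k - 1 and 2k, get the colour k
    mod 2.  Every crossing, the clasp included, changes this colour, so
    distances along the knot are known modulo 2 without tracing any path. *)
Lemma odd_uphalf_next x : odd (uphalf (next x)) = ~~ odd (uphalf x).
Proof.
have [[k s] <-] := strand_in_onto (VT a) x; rewrite /next next_strand_in.
have hk := ltn_ord k; have [b /(_ s)] := VT_crossingP k.
by case: ifP => k0 [-> ->]; case: ifP => _; rewrite !VT_arcE ?uphalfE /=; lia.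
Qed.

Lemma odd_findex x y : odd (findex next x y) = odd (uphalf x) (+) odd (uphalf y).
Proof.
have iterE n : odd (uphalf (iter n next x)) = odd n (+) odd (uphalf x).
  by elim: n => //= n IH; rewrite odd_uphalf_next IH addNb.
by rewrite -[in RHS](iter_findex (VT_knot x y)) iterE addbC addbK.
Qed.

Lemma odd_crossing_VT (k : 'I_(ncross a).+1) :
  odd_crossing (VT a) k = (k == 0%N :> nat) ==> odd N.
Proof.
rewrite /odd_crossing odd_findex; have hk := ltn_ord k.
have [b bE] := VT_crossingP k; move: (bE true) (bE false).
rewrite /strand_in /strand_out /=; case: ifP => k0 [_ ->] [-> _].
  by rewrite !VT_arcE /=; lia.
by case: b {bE} => /=; rewrite -oddD !VT_arcE /=; lia.
Qed.

Lemma odd_writhe_VT : odd_writhe (VT a) =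
  \sum_(k < N) (if twist_pos a k then 1 else -1) +
  (odd N)%:R * (if clasp_pos a then 1 else -1).
Proof.
rewrite /odd_writhe big_mkcond big_ord_recl [RHS]addrC odd_crossing_VT /=.
congr (_ + _).
  by case: (odd N); rewrite ?mul1r ?mul0r.
apply: eq_bigr => k _.
rewrite odd_crossing_VT /= /sign /VT_crossing /= add0n /twist_pos.
by case: (nth _ _ _) => i r; case: (0 < _) (_ == 0) => [] [].
Qed.

Lemma size_twist : size (twist a) = N.
Proof.
rewrite size_allpairs_dep sumnE big_map /N /ncross [RHS](big_nth 0).
rewrite /index_iota subn0.
by apply: eq_bigr => i _; rewrite size_iota.
Qed.

(** The types alternate within a block, so block i has floor(|a_i| / 2)
    crossings of type 2, and one more if a_i is odd and the block starts
    with type 2, that is, if s(i-1) is odd.  For a_i odd, s(i-1) and s(i)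
    have the same parity, and the extra crossings are counted by delta. *)
Lemma type2_count_VT : (type2_count (twist_type1 a) N)%:Z =
  delta a + \sum_(i < size a) (`|(a`_i)%R| %/ 2)%N%:Z.
Proof.
pose F (ir : nat * nat) := nat_of_bool (parity (psum a ir.1 + ir.2%:Z) != 0).
have -> : type2_count (twist_type1 a) N = (\sum_(ir <- twist a) F ir)%N.
  rewrite (big_nth (0, 0)%N) size_twist big_mkord; apply: eq_bigr => k _.
  by rewrite /F /twist_type1; case: (nth _ _ _).
rewrite big_allpairs_dep -{1}(subn0 (size a)) big_mkord.
rewrite (big_morph Posz PoszD (erefl _)).
rewrite /delta -big_split /=; apply: eq_bigr => i _.
pose s := `|psum a i|%N.
transitivity (\sum_(r < `|(a`_i)%R|) odd (s + r))%N%:Z.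
  congr Posz; rewrite -{1}(subn0 `|_|%N) big_mkord; apply: eq_bigr => r _.
  rewrite /F parityE /=; congr nat_of_bool; lia.
have -> : psum a i.+1 = psum a i + (a`_i + 1) by apply: big_ord_recr.
rewrite sum_odd_shift !parityE /s; move: a`_i (psum a i) => x y.
rewrite !odd_abszD /=.
by rewrite divn2; case: (odd `|x|) (odd `|y|) => [] [] /=; lia.
Qed.

End Writhe.

Theorem theorem4 (n : nat) (a : n.-tuple int) (n_ge1 : (1 <= n)%N) :
  exists q : {poly {poly int}},
    is_reduced_Delta0 (VT a) q /\
    2 * q.[-1, -1] =
      (-1) ^ (delta a + psum a n + \sum_(i < n) (`|tnth a i|%N %/ 2)%N%:Z)
      * odd_writhe (VT a).
Proof.
have [q [q_red q_at]] := VT_reduced_Delta0 a; exists q; split=> //.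
rewrite q_at odd_writhe_VT; congr (_ * _).
have floorE : \sum_(i < n) (`|tnth a i| %/ 2)%N%:Z =
    \sum_(i < size a) (`|(a`_i)%R| %/ 2)%N%:Z.
  by rewrite size_tuple; apply: eq_bigr => i _; rewrite (tnth_nth 0).
rewrite addrAC floorE -type2_count_VT exprzDr ?unitrN1 //.
by rewrite (exprN1_parity (psum a n)) /clasp_pos size_tuple.
Qed.
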